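(* Let $r\ge 2$. No map in $\mathrm{ITM}(r)$ is structurally stable, and no map in $\mathrm{ITM}(r)$ is $\Omega$-stable.
   Context: Let $I=[0,1)$. An interval translation mapping (ITM) on $r$ intervals is a map $T:I\to I$ given by parameters $0=\beta_0<\beta_1<\dots<\beta_{r-1}<\beta_r=1$ and $\gamma_1,\dots,\gamma_r\in\mathbb R$ with $\gamma_i\in[-\beta_{i-1},1-\beta_i]$, via $T(x)=x+\gamma_i$ for $x\in I_i=[\beta_{i-1},\beta_i)$. $\mathrm{ITM}(r)$ is the set of parameter vectors $(\gamma_1,\dots,\gamma_r,\beta_1,\dots,\beta_{r-1})$ with the subspace topology from $\mathbb R^{2r-1}$; maps are identified with their parameters. $X(T)=\bigcap_{n\ge0}T^n(I)$, whose closure is the non-wandering set of $T$; $T$ maps $X(T)$ into itself. $T\in\mathrm{ITM}(r)$ is structurally stable if there is a neighbourhood $\mathcal U$ of $T$ in $\mathrm{ITM}(r)$ such that for each $\tilde T\in\mathcal U$ there is a homeomorphism $h:I\to I$ with $h\circ T=\tilde T\circ h$. $T$ is $\Omega$-stable if there is a neighbourhood $\mathcal U$ of $T$ in $\mathrm{ITM}(r)$ such that for each $\tilde T\in\mathcal U$ the dynamics on the non-wandering sets are conjugate, i.e. there is a homeomorphism $h:X(T)\to X(\tilde T)$ with $h\circ T=\tilde T\circ h$ on $X(T)$. *)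

(* Defs.v *)
From HB Require Import structures.
From mathcomp Require Import all_boot all_order all_algebra.
From mathcomp Require Import all_classical all_reals all_analysis.

Set Implicit Arguments.
Unset Strict Implicit.
Unset Printing Implicit Defensive.

Import Order.TTheory GRing.Theory Num.Theory.
Import numFieldNormedType.Exports.

Local Open Scope classical_set_scope.
Local Open Scope ring_scope.

(* A parameter vector (gamma_1, .., gamma_r, beta_1, .., beta_(r-1)) is a row
   vector of length r + r.-1. Ordinals start at 0, so
     itm_gamma p i = gamma_(i+1)   for i : 'I_r,
     itm_beta p j  = beta_j        for 0 <= j <= r,
   with beta_0 = 0 and beta_r = 1. *)
Section ITM.
Context {R : realType} {r : nat}.
Implicit Types p q : 'rV[R]_(r + r.-1).

Definition itm_gamma p (i : 'I_r) : R := lsubmx p ord0 i.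

(* The value for j > r is junk. *)
Definition itm_beta p (j : nat) : R :=
  if j is k.+1 then
    if (insub k : option 'I_r.-1) is Some l then rsubmx p ord0 l else 1
  else 0.

Definition itm_piece p (i : 'I_r) : set R := `[itm_beta p i, itm_beta p i.+1[.

Definition ITM : set 'rV[R]_(r + r.-1) :=
  [set p | (forall i : 'I_r, itm_beta p i < itm_beta p i.+1) /\
           (forall i : 'I_r, - itm_beta p i <= itm_gamma p i
                             <= 1 - itm_beta p i.+1)].

(* For p in ITM, the pieces partition [0, 1[ and exactly one i is eligible for
   each x in [0, 1[; the values outside [0, 1[ are junk and never used. *)
Definition itm_map p (x : R) : R :=
  if [pick i : 'I_r | x \in itm_piece p i] is Some i then x + itm_gamma p i
  else x.

Definition itm_X p : set R :=
  \bigcap_(n in [set: nat]) (iter n (itm_map p) @` `[0, 1[).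

End ITM.

Arguments ITM R r : clear implicits.

(* Homeomorphisms between subsets A and B of R with their subspace topologies
   are given by functions on R of which only the restrictions matter. *)
Definition homeo_on {R : realType} (A B : set R) (h : R -> R) : Prop :=
  {within A, continuous h} /\
  exists g : R -> R,
    [/\ {within B, continuous g},
        (forall x, A x -> B (h x) /\ g (h x) = x) &
        (forall y, B y -> A (g y) /\ h (g y) = y)].

Definition conjugate_on {R : realType} (A B : set R) (S T : R -> R) : Prop :=
  exists h : R -> R,
    homeo_on A B h /\ (forall x, A x -> h (S x) = T (h x)).

(* The filter [within (ITM R r) (nbhs p)] is that of the neighbourhoods of p
   in ITM R r for the subspace topology. *)
Definition structurally_stable {R : realType} {r : nat}
    (p : 'rV[R]_(r + r.-1)) : Prop :=
  \forall q \near within (ITM R r) (nbhs p),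
    conjugate_on `[0, 1[ `[0, 1[ (itm_map p) (itm_map q).

Definition Omega_stable {R : realType} {r : nat}
    (p : 'rV[R]_(r + r.-1)) : Prop :=
  \forall q \near within (ITM R r) (nbhs p),
    conjugate_on (itm_X p) (itm_X q) (itm_map p) (itm_map q).

(* Main.v *)
Require Import Defs.
From mathcomp Require Import all_boot all_order all_algebra.
From mathcomp Require Import all_classical all_reals all_analysis.
From mathcomp Require Import zify ring lra.

(** Conjugacies preserve the periods of periodic points, while an arbitrarily
    small change of the translations can create a periodic orbit or destroy all
    orbits of a given period.

    Near any [p] in [ITM R r] one finds, without moving the [beta]s, a map whose
    translations all lie in a prescribed fine progression [d (P Z + 1)]
    ([near_progression]); there is room for this because no piece has length 1
    when [r >= 2].  After [n] steps such a map has moved every point by an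
    element of [d (P Z + n)] ([iter_progression]).
    - With [P = 1] all points of an orbit differ by multiples of [d], and [0, 1[
      contains finitely many such points, so the map has a periodic orbit.
    - With [P > n] the displacement after [n >= 1] steps is never 0, so the map has
      no point of period [n].

    Suppose that [p] were stable.  Choosing a nearby map of the first kind gives
    a period [n] for [p]; then choosing a nearby map of the second kind with
    [P = n + 1] contradicts this.  For structural stability the conjugacy acts
    on [0, 1[, for Omega-stability on [itm_X], which contains all periodic
    points; [not_stable] treats both cases at once. *)

Set Implicit Arguments.
Unset Strict Implicit.
Unset Printing Implicit Defensive.

Import Order.TTheory GRing.Theory Num.Theory.
Import numFieldNormedType.Exports.

Local Open Scope classical_set_scope.
Local Open Scope ring_scope.

(* Keeps the end points [itm_beta p i.+1] folded. *)
Arguments itm_beta {R r} p j : simpl never.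

Section Dynamics.
Context {R : realType} {r : nat}.
Implicit Types (p : 'rV[R]_(r + r.-1)) (x : R).

Lemma itm_beta_ge p j : (0 < r <= j)%N -> itm_beta p j = 1.
Proof.
case: j => [|j] rj; rewrite /itm_beta; first by lia.
by rewrite insubF//; apply/negbTE; lia.
Qed.

Lemma itm_beta_r p : (0 < r)%N -> itm_beta p r = 1.
Proof. by move=> r0; rewrite itm_beta_ge ?r0/=. Qed.

Lemma itm_beta_lt p i j : ITM R r p -> (i < j <= r)%N ->
  itm_beta p i < itm_beta p j.
Proof.
move=> [bp _]; elim: j => [|j IH] /andP[//]; rewrite ltnS => ij jr.
have bj := bp (Ordinal jr).
move: ij; rewrite leq_eqVlt => /predU1P[->//|ij].
by apply: lt_trans bj; apply: IH; rewrite ij ltnW.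
Qed.

Lemma itm_piece_ex p x : (0 < r)%N -> `[0, 1[%classic x ->
  exists i : 'I_r, x \in itm_piece p i.
Proof.
move=> r0 /=; rewrite in_itv/= => /andP[x0 x1].
suff below j : (j <= r)%N -> x < itm_beta p j ->
    exists i : 'I_r, x \in itm_piece p i.
  by apply: (below r) => //; rewrite itm_beta_r.
elim: j => [|j IH] jr xj; first by rewrite /= ltNge x0 in xj.
have [xj'|jx] := ltP x (itm_beta p j); first by apply: IH => //; exact: ltnW.
by exists (Ordinal jr); rewrite inE /itm_piece/= in_itv/= jx.
Qed.

Lemma itm_mapP p x : (0 < r)%N -> `[0, 1[%classic x ->
  exists2 i : 'I_r, x \in itm_piece p i & itm_map p x = x + itm_gamma p i.
Proof.
move=> r0 x01; rewrite /itm_map; case: pickP => [i xi|none]; first by exists i.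
by have [i] := itm_piece_ex p r0 x01; rewrite none.
Qed.

Lemma itm_map_unit p x : (0 < r)%N -> ITM R r p -> `[0, 1[%classic x ->
  `[0, 1[%classic (itm_map p x).
Proof.
move=> r0 [_ gp] x01; have [i + ->] := itm_mapP p r0 x01.
rewrite inE /itm_piece/= !in_itv/= => /andP[xi ix].
have /andP[gi ig] := gp i; apply/andP; split; lra.
Qed.

Lemma iter_itm_unit p n x : (0 < r)%N -> ITM R r p -> `[0, 1[%classic x ->
  `[0, 1[%classic (iter n (itm_map p) x).
Proof. by move=> r0 Ip x01; elim: n => //= n IH; exact: itm_map_unit. Qed.

Lemma itm_X_unit p x : itm_X p x -> `[0, 1[%classic x.
Proof. by move=> /(_ 0%N I)[y y01 <-]. Qed.

Lemma itm_X_map p x : (0 < r)%N -> ITM R r p -> itm_X p x ->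
  itm_X p (itm_map p x).
Proof.
move=> r0 Ip Xx n _; have [y y01 <-] := Xx n I.
by exists (itm_map p y); [exact: itm_map_unit|rewrite -iterSr].
Qed.

Lemma itm_X_periodic p x n : (0 < r)%N -> ITM R r p -> `[0, 1[%classic x ->
  (0 < n)%N -> iter n (itm_map p) x = x -> itm_X p x.
Proof.
move=> r0 Ip x01 n0 px m _.
have pk k : iter (k * n) (itm_map p) x = x.
  by elim: k => // k IH; rewrite mulSn iterD IH.
(* [x] is the [m]-th image of a later point of its own orbit *)
exists (iter (m * n - m) (itm_map p) x); first exact: iter_itm_unit.
by rewrite -iterD subnKC// leq_pmulr.
Qed.

(** Modulo [d P] every step adds [d], whichever piece it starts from: modulo
    [P] the displacement counts the steps. *)
Lemma iter_progression p (d : R) (P n : nat) x : (0 < r)%N -> ITM R r p ->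
  (forall i : 'I_r, exists k : int, itm_gamma p i = d * (k%:~R * P%:R + 1)) ->
  `[0, 1[%classic x ->
  exists k : int, iter n (itm_map p) x = x + d * (k%:~R * P%:R + n%:R).
Proof.
move=> r0 Ip gp x01; elim: n => [|n [k IH]].
  by exists 0; rewrite /= mul0r addr0 mulr0 addr0.
have [i _ /= ->] := itm_mapP p r0 (iter_itm_unit n r0 Ip x01).
have [l ->] := gp i; exists (k + l).
by rewrite IH -natr1 rmorphD/=; ring.
Qed.

(** The orbit of 0 stays in [d Z] and in [0, 1[, hence takes finitely many
    values and repeats. *)
Lemma progression_periodic p (d : R) : (0 < r)%N -> ITM R r p -> 0 < d ->
  (forall i : 'I_r, exists k : int, itm_gamma p i = d * (k%:~R * 1%:R + 1)) ->
  exists x n, [/\ `[0, 1[%classic x, (0 < n)%N & iter n (itm_map p) x = x].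
Proof.
move=> r0 Ip d0 gp.
have z01 : `[0, 1[%classic (0 : R) by rewrite /= in_itv/= lexx ltr01.
pose N := (Num.truncn d^-1).+1.
have orb n : exists j : 'I_N, iter n (itm_map p) 0 = d * (j : nat)%:R.
  have [k kE] := iter_progression n r0 Ip gp z01.
  have := iter_itm_unit n r0 Ip z01; rewrite /= in_itv/= {}kE.
  rewrite add0r mulr1 -[n%:R]/(n%:Z%:~R) -rmorphD/=.
  case: (k + n%:Z)%R => [j|j] /andP[ge0 lt1].
    suff jN : (j < N)%N by exists (Ordinal jN).
    rewrite -(ltr_nat R); apply: lt_trans (truncnS_gt d^-1).
    by rewrite -(ltr_pM2l d0) divff ?gt_eqF.
  by move: ge0; rewrite pmulr_rge0// ler0z.
have [f fE] := choice orb.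
have /injectivePn[a [b ab fab]] : ~~ injectiveb (fun a : 'I_N.+1 => f a).
  by apply/negP => /injectiveP/leq_card; rewrite !card_ord ltnn.
wlog {ab} ab : a b fab / (a < b)%N => [main|].
  move: ab; rewrite -val_eqE neq_ltn => /orP[|]; first exact: main.
  by apply: main; rewrite fab.
exists (iter a (itm_map p) 0), (b - a)%N.
split; [exact: iter_itm_unit|by rewrite subn_gt0|].
by rewrite -iterD subnK 1?ltnW// !fE fab.
Qed.

(** The number [k (n + 1) + n] is congruent to -1 modulo [n + 1 > 1], so it is
    not 0. *)
Lemma progression_aperiodic p (d : R) n x : (0 < r)%N -> ITM R r p -> 0 < d ->
  (forall i : 'I_r,
    exists k : int, itm_gamma p i = d * (k%:~R * n.+1%:R + 1)) ->
  (0 < n)%N -> `[0, 1[%classic x -> iter n (itm_map p) x <> x.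
Proof.
move=> r0 Ip d0 gp n0 x01.
have [k ->] := iter_progression n r0 Ip gp x01.
move=> /eqP; rewrite addrC -subr_eq0 addrK mulf_eq0 gt_eqF//=.
rewrite -[n%:R]/(n%:Z%:~R) -[n.+1%:R]/(n.+1%:Z%:~R) -rmorphM -rmorphD/=.
rewrite intr_eq0 => /eqP; have [k0|k0] := leP 0 k; nia.
Qed.

End Dynamics.

Section Perturbation.
Context {R : realType}.

Lemma progression_itv (d u v : R) (P : nat) : 0 < d -> (0 < P)%N ->
  d * P%:R < v - u -> exists k : int, u < d * (k%:~R * P%:R + 1) < v.
Proof.
move=> d0 P0 duv; have PR0 : 0 < P%:R :> R by rewrite ltr0n.
have /andP[] := floor_itv ((u / d - 1) / P%:R).
rewrite ler_pdivlMr// ltr_pdivrMr// rmorphD/= => kle klt.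
exists (Num.floor ((u / d - 1) / P%:R) + 1); rewrite rmorphD/=.
move: kle klt; set k : R := (Num.floor _)%:~R.
rewrite lerBrDr ltrBlDr ler_pdivlMr// ltr_pdivrMr// => kle klt.
apply/andP; split; first by rewrite mulrC.
nra.
Qed.

(** Stated for all small [d] so that finitely many pieces can share one [d]. *)
Lemma near_progression_pt (a b c e : R) (P : nat) :
  a < b -> a <= c <= b -> 0 < e -> (0 < P)%N ->
  \forall d \near 0^'+, exists2 k : int,
    a <= d * (k%:~R * P%:R + 1) <= b & `|c - d * (k%:~R * P%:R + 1)| < e.
Proof.
move=> ab /andP[ac cb] e0 P0; have PR0 : 0 < P%:R :> R by rewrite ltr0n.
pose u := Num.max a (c - e); pose v := Num.min b (c + e).
have uv : u < v.
  by rewrite lt_min !gt_max; apply/andP; split; apply/andP; split; lra.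
near=> d.
have d0 : 0 < d by near: d; exact: nbhs_right_gt.
have [|k] := @progression_itv d u v P d0 P0.
  rewrite -ltr_pdivlMr//; near: d; apply: nbhs_right_lt.
  by rewrite divr_gt0// subr_gt0.
rewrite lt_min gt_max => /andP[/andP[ak ek] /andP[kb ke]].
exists k; first by rewrite !ltW.
by rewrite ltr_norml; apply/andP; split; lra.
Unshelve. all: by end_near. Qed.

Context {r : nat}.

(** For [r >= 2] each [gamma] ranges over a nondegenerate interval. *)
Lemma itm_piece_lt1 (p : 'rV[R]_(r + r.-1)) (i : 'I_r) : (2 <= r)%N ->
  ITM R r p -> - itm_beta p i < 1 - itm_beta p i.+1.
Proof.
move=> r2 Ip; have r0 : (0 < r)%N by exact: ltnW.
have ltir := ltn_ord i.
have i0 : (0 < i)%N -> 0 < itm_beta p i.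
  by move=> ?; rewrite -[0]/(itm_beta p 0); apply: itm_beta_lt => //; lia.
have i1 : (i.+1 < r)%N -> itm_beta p i.+1 < 1.
  by move=> ?; rewrite -(itm_beta_r p r0); apply: itm_beta_lt => //; lia.
have [ir|ri] := ltnP i.+1 r.
  have : 0 <= itm_beta p i by case: (posnP i) => [->//|/i0/ltW].
  by move: (i1 ir); lra.
have -> : i.+1 = r by lia.
by rewrite itm_beta_r//; move: (i0 ltac:(lia)); lra.
Qed.

Lemma near_progression (p : 'rV[R]_(r + r.-1)) (A : set 'rV[R]_(r + r.-1))
    (P : nat) : (2 <= r)%N -> ITM R r p -> (0 < P)%N ->
  (\forall q \near within (ITM R r) (nbhs p), A q) ->
  exists q d, [/\ ITM R r q, A q, 0 < d & forall i : 'I_r,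
    exists k : int, itm_gamma q i = d * (k%:~R * P%:R + 1)].
Proof.
move=> r2 Ip P0 /nbhs_ballP[e /= e0 pA]; have [bp gp] := Ip.
have : \forall d \near 0^'+, forall i : 'I_r, exists2 k : int,
    - itm_beta p i <= d * (k%:~R * P%:R + 1) <= 1 - itm_beta p i.+1 &
    `|itm_gamma p i - d * (k%:~R * P%:R + 1)| < e.
  apply: filter_forall => i.
  exact: near_progression_pt (itm_piece_lt1 i r2 Ip) (gp i) e0 P0.
move=> /(filterI (nbhs_right_gt (0 : R)))/filter_ex[d [d0 dk]].
have [k kI ke] := fin_all_exists2 dk.
pose q : 'rV[R]_(r + r.-1) :=
  row_mx (\row_i (d * ((k i)%:~R * P%:R + 1))) (rsubmx p).
have qg i : itm_gamma q i = d * ((k i)%:~R * P%:R + 1).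
  by rewrite /itm_gamma row_mxKl mxE.
have qb j : itm_beta q j = itm_beta p j by rewrite /itm_beta row_mxKr.
have Iq : ITM R r q by split=> i; rewrite ?qg !qb.
exists q, d; split=> //; last by move=> i; exists (k i).
apply: pA => //; split=> // i j; rewrite -[p]hsubmxK ord1.
case: (split_ordP j) => l ->; last by rewrite !row_mxEr; exact: ballxx.
by rewrite !row_mxEl !mxE; have := ke l; rewrite /itm_gamma mxE.
Qed.

(** [dom p] is the set on which a stability notion conjugates the dynamics. *)
Lemma not_stable (dom : 'rV[R]_(r + r.-1) -> set R) : (2 <= r)%N ->
  (forall p (x : R), ITM R r p -> dom p x -> dom p (itm_map p x)) ->
  (forall p x, dom p x -> `[0, 1[%classic x) ->
  (forall p (x : R) n, ITM R r p -> `[0, 1[%classic x -> (0 < n)%N ->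
    iter n (itm_map p) x = x -> dom p x) ->
  forall p, ITM R r p -> ~ \forall q \near within (ITM R r) (nbhs p),
    conjugate_on (dom p) (dom q) (itm_map p) (itm_map q).
Proof.
move=> r2 domT dom01 domP p Ip st; have r0 : (0 < r)%N by exact: ltnW.
have dom_iter n x : dom p x -> dom p (iter n (itm_map p) x).
  by move=> px; elim: n => //= n IH; exact: domT.
have conj_iter (S h : R -> R) n x :
    (forall y, dom p y -> h (itm_map p y) = S (h y)) -> dom p x ->
    h (iter n (itm_map p) x) = iter n S (h x).
  by move=> hT px; elim: n => //= n IH; rewrite hT ?IH//; exact: dom_iter.
have [q [d [Iq [h [[_ [g [_ hK gK]]] hT]] d0 qg]]] :=
  near_progression r2 Ip (ltn0Sn 0) st.
have [y [n [y01 n0 yn]]] := progression_periodic r0 Iq d0 qg.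
have [px hx] := gK y (domP q y n Iq y01 n0 yn).
have pn : iter n (itm_map p) (g y) = g y.
  have [_ <-] := hK _ (dom_iter n _ px).
  by rewrite (conj_iter (itm_map q))// hx yn.
have [q' [d' [Iq' [h' [[_ [g' [_ hK' _]]] hT']] d'0 qg']]] :=
  near_progression r2 Ip (ltn0Sn n) st.
have [/dom01 h'01 _] := hK' _ px.
apply: (progression_aperiodic r0 Iq' d'0 qg' n0 h'01).
by rewrite -(conj_iter (itm_map q'))// pn.
Qed.

End Perturbation.

Theorem corollary1p2 (R : realType) (r : nat) (hr : (2 <= r)%N) :
  (forall p, ITM R r p -> ~ structurally_stable p) /\
  (forall p, ITM R r p -> ~ Omega_stable p).
Proof.
have r0 : (0 < r)%N by exact: ltnW.
split.
  apply: (@not_stable R r (fun=> `[0, 1[%classic)) => // p x Ip x01.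
  exact: itm_map_unit.
apply: not_stable => //.
- by move=> p x; exact: itm_X_map.
- exact: itm_X_unit.
- by move=> p x n; exact: itm_X_periodic.
Qed.
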